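(* Let $\mathsf{A}=a_0+a_1\mathbf{e}_1+a_2\mathbf{e}_2+a_3\mathbf{e}_3+a_{12}\mathbf{e}_{12}+a_{13}\mathbf{e}_{13}+a_{23}\mathbf{e}_{23}+a_{123}I$ be an arbitrary element of the real Clifford algebra $\mathit{Cl}_{0,3}$ (all coefficients real). Put $$a_{+}=\sqrt{(a_{3}-a_{12})^2+(a_{2}+a_{13})^2+(a_{1}-a_{23})^2},\qquad a_{-}=\sqrt{(a_{3}+a_{12})^2+(a_{2}-a_{13})^2+(a_{1}+a_{23})^2}.$$ Then $\exp(\mathsf{A})=b_0+b_1\mathbf{e}_1+b_2\mathbf{e}_2+b_3\mathbf{e}_3+b_{12}\mathbf{e}_{12}+b_{13}\mathbf{e}_{13}+b_{23}\mathbf{e}_{23}+b_{123}I$, where the real coefficients are $$\begin{aligned} b_{0}&=\tfrac12 e^{a_0}\bigl(e^{a_{123}}\cos a_{+}+e^{-a_{123}}\cos a_{-}\bigr),\\ b_{123}&=\tfrac12 e^{a_0}\bigl(e^{a_{123}}\cos a_{+}-e^{-a_{123}}\cos a_{-}\bigr),\\ b_{1}&=\tfrac12 e^{a_0}\Bigl(e^{a_{123}}(a_1-a_{23})\tfrac{\sin a_{+}}{a_{+}}+e^{-a_{123}}(a_1+a_{23})\tfrac{\sin a_{-}}{a_{-}}\Bigr),\\ b_{2}&=\tfrac12 e^{a_0}\Bigl(e^{a_{123}}(a_2+a_{13})\tfrac{\sin a_{+}}{a_{+}}+e^{-a_{123}}(a_2-a_{13})\tfrac{\sin a_{-}}{a_{-}}\Bigr),\\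 b_{3}&=\tfrac12 e^{a_0}\Bigl(e^{a_{123}}(a_3-a_{12})\tfrac{\sin a_{+}}{a_{+}}+e^{-a_{123}}(a_3+a_{12})\tfrac{\sin a_{-}}{a_{-}}\Bigr),\\ b_{12}&=\tfrac12 e^{a_0}\Bigl(-e^{a_{123}}(a_3-a_{12})\tfrac{\sin a_{+}}{a_{+}}+e^{-a_{123}}(a_3+a_{12})\tfrac{\sin a_{-}}{a_{-}}\Bigr),\\ b_{13}&=\tfrac12 e^{a_0}\Bigl(e^{a_{123}}(a_2+a_{13})\tfrac{\sin a_{+}}{a_{+}}-e^{-a_{123}}(a_2-a_{13})\tfrac{\sin a_{-}}{a_{-}}\Bigr),\\ b_{23}&=\tfrac12 e^{a_0}\Bigl(-e^{a_{123}}(a_1-a_{23})\tfrac{\sin a_{+}}{a_{+}}+e^{-a_{123}}(a_1+a_{23})\tfrac{\sin a_{-}}{a_{-}}\Bigr). \end{aligned}$$ In the special cases $a_{+}=0$ and/or $a_{-}=0$, the same formulas hold with each term containing $\frac{\sin a_{\pm}}{a_{\pm}}$ for the vanishing $a_{\pm}$ replaced by $0$ (and the corresponding $\cos a_{\pm}$ equal to $1$).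
   Context: $\mathit{Cl}_{0,3}$ is the real associative unital algebra (of dimension 8) generated by $\mathbf{e}_1,\mathbf{e}_2,\mathbf{e}_3$ with $\mathbf{e}_i\mathbf{e}_j+\mathbf{e}_j\mathbf{e}_i=0$ for $i\neq j$ and $\mathbf{e}_1^2=\mathbf{e}_2^2=\mathbf{e}_3^2=-1$. Its basis is $\{1,\mathbf{e}_1,\mathbf{e}_2,\mathbf{e}_3,\mathbf{e}_{12},\mathbf{e}_{13},\mathbf{e}_{23},\mathbf{e}_{123}=I\}$, where $\mathbf{e}_{ij}=\mathbf{e}_i\mathbf{e}_j$ for $i<j$ and $I=\mathbf{e}_1\mathbf{e}_2\mathbf{e}_3$. The exponential is $\exp(\mathsf{A})=\sum_{k\ge0}\mathsf{A}^k/k!$ with respect to the algebra (geometric) product. *)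

(* Defs.v *)
From HB Require Import structures.
From mathcomp Require Import all_boot all_order all_algebra.
From mathcomp Require Import all_classical all_reals all_analysis.
From mathcomp Require Import ring.

Set Implicit Arguments.
Unset Strict Implicit.
Unset Printing Implicit Defensive.

Import Order.TTheory GRing.Theory Num.Theory.
Import numFieldNormedType.Exports.

Local Open Scope ring_scope.

(* The real Clifford algebra Cl_{0,3} on R^8 (with the topology of R^8).
   Coordinates 0, ..., 7 refer to the basis
     1, e1, e2, e3, e12, e13, e23, e123,
   in this order. *)
Definition Cl03 (R : realType) : Type := 'rV[R]_8.

HB.instance Definition _ (R : realType) :=
  NormedModule.copy (Cl03 R) 'rV[R]_8.

Definition Cl03_coord (R : realType) (x : Cl03 R) (k : nat) : R :=
  x ord0 (inord k).

Definition Cl03_of_seq (R : realType) (s : seq R) : Cl03 R :=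
  \row_(i < 8) s`_i.

Local Notation "x `[ k ]" := (Cl03_coord x k) (at level 3, format "x `[ k ]").

(* The bilinear extension of the multiplication table of the basis, obtained
   by sorting the concatenated words in e1, e2, e3 with e_i e_j = - e_j e_i
   and e_i ^ 2 = -1. *)
Definition Cl03_mul (R : realType) (x y : Cl03 R) : Cl03 R :=
  Cl03_of_seq [::
    x`[0] * y`[0] - x`[1] * y`[1] - x`[2] * y`[2] - x`[3] * y`[3]
      - x`[4] * y`[4] - x`[5] * y`[5] - x`[6] * y`[6] + x`[7] * y`[7] ;
    x`[0] * y`[1] + x`[1] * y`[0] + x`[2] * y`[4] + x`[3] * y`[5]
      - x`[4] * y`[2] - x`[5] * y`[3] - x`[6] * y`[7] - x`[7] * y`[6] ;
    x`[0] * y`[2] - x`[1] * y`[4] + x`[2] * y`[0] + x`[3] * y`[6]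
      + x`[4] * y`[1] + x`[5] * y`[7] - x`[6] * y`[3] + x`[7] * y`[5] ;
    x`[0] * y`[3] - x`[1] * y`[5] - x`[2] * y`[6] + x`[3] * y`[0]
      - x`[4] * y`[7] + x`[5] * y`[1] + x`[6] * y`[2] - x`[7] * y`[4] ;
    x`[0] * y`[4] + x`[1] * y`[2] - x`[2] * y`[1] - x`[3] * y`[7]
      + x`[4] * y`[0] + x`[5] * y`[6] - x`[6] * y`[5] - x`[7] * y`[3] ;
    x`[0] * y`[5] + x`[1] * y`[3] + x`[2] * y`[7] - x`[3] * y`[1]
      - x`[4] * y`[6] + x`[5] * y`[0] + x`[6] * y`[4] + x`[7] * y`[2] ;
    x`[0] * y`[6] - x`[1] * y`[7] + x`[2] * y`[3] - x`[3] * y`[2]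
      + x`[4] * y`[5] - x`[5] * y`[4] + x`[6] * y`[0] - x`[7] * y`[1] ;
    x`[0] * y`[7] + x`[1] * y`[6] - x`[2] * y`[5] + x`[3] * y`[4]
      + x`[4] * y`[3] - x`[5] * y`[2] + x`[6] * y`[1] + x`[7] * y`[0]
  ].

Section Cl03_ring.
Variable R : realType.
Implicit Types x y z : Cl03 R.

Lemma Cl03_coordK (s : seq R) k : (k < 8)%N -> (Cl03_of_seq s)`[k] = s`_k.
Proof. by move=> k8; rewrite /Cl03_coord mxE inordK. Qed.

Lemma Cl03P x y :
  (forall k, (k < 8)%N -> x`[k] = y`[k]) -> x = y.
Proof.
move=> xy; apply/rowP => i; have := xy i (ltn_ord i).
by rewrite /Cl03_coord inord_val.
Qed.

Lemma Cl03_coordD x y k : (x + y)`[k] = x`[k] + y`[k].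
Proof. by rewrite /Cl03_coord mxE. Qed.

Lemma Cl03_coordZ a x k : (a *: x)`[k] = a * x`[k].
Proof. by rewrite /Cl03_coord mxE. Qed.

Lemma Cl03_ind (P : Cl03 R -> Prop) :
  (forall x0 x1 x2 x3 x4 x5 x6 x7 : R,
    P (Cl03_of_seq [:: x0; x1; x2; x3; x4; x5; x6; x7])) ->
  forall x, P x.
Proof.
move=> Ps x; suff -> : x = Cl03_of_seq [seq x`[k] | k <- iota 0 8] by exact: Ps.
by apply: Cl03P => k k8; rewrite Cl03_coordK// (nth_map 0%N) ?size_iota// nth_iota.
Qed.

Lemma Cl03_add_seq (x0 x1 x2 x3 x4 x5 x6 x7 y0 y1 y2 y3 y4 y5 y6 y7 : R) :
  Cl03_of_seq [:: x0; x1; x2; x3; x4; x5; x6; x7] + Cl03_of_seq [:: y0; y1; y2; y3; y4; y5; y6; y7] =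
  Cl03_of_seq [:: x0 + y0; x1 + y1; x2 + y2; x3 + y3;
                  x4 + y4; x5 + y5; x6 + y6; x7 + y7].
Proof. by apply: Cl03P; do 8 (case; first by
  rewrite Cl03_coordD !Cl03_coordK). Qed.

Lemma Cl03_scale_seq (a x0 x1 x2 x3 x4 x5 x6 x7 : R) :
  a *: Cl03_of_seq [:: x0; x1; x2; x3; x4; x5; x6; x7] =
  Cl03_of_seq [:: a * x0; a * x1; a * x2; a * x3;
                  a * x4; a * x5; a * x6; a * x7].
Proof. by apply: Cl03P; do 8 (case; first by
  rewrite Cl03_coordZ !Cl03_coordK). Qed.

Lemma Cl03_mul_seq (x0 x1 x2 x3 x4 x5 x6 x7 y0 y1 y2 y3 y4 y5 y6 y7 : R) :
  Cl03_mul (Cl03_of_seq [:: x0; x1; x2; x3; x4; x5; x6; x7])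
           (Cl03_of_seq [:: y0; y1; y2; y3; y4; y5; y6; y7]) =
  Cl03_of_seq [::
    x0 * y0 - x1 * y1 - x2 * y2 - x3 * y3
      - x4 * y4 - x5 * y5 - x6 * y6 + x7 * y7 ;
    x0 * y1 + x1 * y0 + x2 * y4 + x3 * y5
      - x4 * y2 - x5 * y3 - x6 * y7 - x7 * y6 ;
    x0 * y2 - x1 * y4 + x2 * y0 + x3 * y6
      + x4 * y1 + x5 * y7 - x6 * y3 + x7 * y5 ;
    x0 * y3 - x1 * y5 - x2 * y6 + x3 * y0
      - x4 * y7 + x5 * y1 + x6 * y2 - x7 * y4 ;
    x0 * y4 + x1 * y2 - x2 * y1 - x3 * y7
      + x4 * y0 + x5 * y6 - x6 * y5 - x7 * y3 ;
    x0 * y5 + x1 * y3 + x2 * y7 - x3 * y1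
      - x4 * y6 + x5 * y0 + x6 * y4 + x7 * y2 ;
    x0 * y6 - x1 * y7 + x2 * y3 - x3 * y2
      + x4 * y5 - x5 * y4 + x6 * y0 - x7 * y1 ;
    x0 * y7 + x1 * y6 - x2 * y5 + x3 * y4
      + x4 * y3 - x5 * y2 + x6 * y1 + x7 * y0

  ].
Proof. by rewrite /Cl03_mul !Cl03_coordK. Qed.

Lemma Cl03_of_seq1 : Cl03_of_seq [:: 1] =
  Cl03_of_seq [:: 1; 0; 0; 0; 0; 0; 0; 0] :> Cl03 R.
Proof. by apply/rowP => i; rewrite !mxE; case: i; do 8 case=> //. Qed.

Lemma Cl03_mulA : associative (@Cl03_mul R).
Proof.
move=> x y z; elim/Cl03_ind: x => *; elim/Cl03_ind: y => *; elim/Cl03_ind: z => *.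
rewrite !Cl03_mul_seq.
by congr (Cl03_of_seq [:: _; _; _; _; _; _; _; _]); ring.
Qed.

Let one : Cl03 R := Cl03_of_seq [:: 1].

Lemma Cl03_mul1r : left_id one (@Cl03_mul R).
Proof.
move=> x; elim/Cl03_ind: x => *.
rewrite /one Cl03_of_seq1 Cl03_mul_seq.
by congr (Cl03_of_seq [:: _; _; _; _; _; _; _; _]); ring.
Qed.

Lemma Cl03_mulr1 : right_id one (@Cl03_mul R).
Proof.
move=> x; elim/Cl03_ind: x => *.
rewrite /one Cl03_of_seq1 Cl03_mul_seq.
by congr (Cl03_of_seq [:: _; _; _; _; _; _; _; _]); ring.
Qed.

Lemma Cl03_mulDl : left_distributive (@Cl03_mul R) +%R.
Proof.
move=> x y z; elim/Cl03_ind: x => *; elim/Cl03_ind: y => *; elim/Cl03_ind: z => *.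
rewrite !(Cl03_add_seq, Cl03_mul_seq).
by congr (Cl03_of_seq [:: _; _; _; _; _; _; _; _]); ring.
Qed.

Lemma Cl03_mulDr : right_distributive (@Cl03_mul R) +%R.
Proof.
move=> x y z; elim/Cl03_ind: x => *; elim/Cl03_ind: y => *; elim/Cl03_ind: z => *.
rewrite !(Cl03_add_seq, Cl03_mul_seq).
by congr (Cl03_of_seq [:: _; _; _; _; _; _; _; _]); ring.
Qed.

Lemma Cl03_one_neq0 : one != 0.
Proof.
apply/eqP => /rowP/(_ ord0); rewrite !mxE /= => /eqP.
by rewrite oner_eq0.
Qed.

HB.instance Definition _ := GRing.Zmodule_isNzRing.Build (Cl03 R)
  Cl03_mulA Cl03_mul1r Cl03_mulr1 Cl03_mulDl Cl03_mulDr Cl03_one_neq0.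

Lemma Cl03_mulE x y : x * y = Cl03_mul x y.
Proof. by []. Qed.

Lemma Cl03_oneE : 1 = Cl03_of_seq [:: 1] :> Cl03 R.
Proof. by []. Qed.

Lemma Cl03_scalerAl (a : R) x y : a *: (x * y) = (a *: x) * y.
Proof.
elim/Cl03_ind: x => *; elim/Cl03_ind: y => *.
rewrite !Cl03_mulE !(Cl03_mul_seq, Cl03_scale_seq).
by congr (Cl03_of_seq [:: _; _; _; _; _; _; _; _]); ring.
Qed.

HB.instance Definition _ :=
  GRing.Lmodule_isLalgebra.Build R (Cl03 R) Cl03_scalerAl.

Lemma Cl03_scalerAr (a : R) x y : a *: (x * y) = x * (a *: y).
Proof.
elim/Cl03_ind: x => *; elim/Cl03_ind: y => *.
rewrite !Cl03_mulE !(Cl03_mul_seq, Cl03_scale_seq).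
by congr (Cl03_of_seq [:: _; _; _; _; _; _; _; _]); ring.
Qed.

HB.instance Definition _ :=
  GRing.Lalgebra_isAlgebra.Build R (Cl03 R) Cl03_scalerAr.

End Cl03_ring.

Section Cl03_basis.
Variable R : realType.

Definition Cl03_e1 : Cl03 R := Cl03_of_seq [:: 0; 1; 0; 0; 0; 0; 0; 0].
Definition Cl03_e2 : Cl03 R := Cl03_of_seq [:: 0; 0; 1; 0; 0; 0; 0; 0].
Definition Cl03_e3 : Cl03 R := Cl03_of_seq [:: 0; 0; 0; 1; 0; 0; 0; 0].
Definition Cl03_e12 : Cl03 R := Cl03_e1 * Cl03_e2.
Definition Cl03_e13 : Cl03 R := Cl03_e1 * Cl03_e3.
Definition Cl03_e23 : Cl03 R := Cl03_e2 * Cl03_e3.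
Definition Cl03_I : Cl03 R := Cl03_e1 * Cl03_e2 * Cl03_e3.

Definition Cl03_mv (c0 c1 c2 c3 c12 c13 c23 c123 : R) : Cl03 R :=
  c0%:A + c1 *: Cl03_e1 + c2 *: Cl03_e2 + c3 *: Cl03_e3
  + c12 *: Cl03_e12 + c13 *: Cl03_e13 + c23 *: Cl03_e23
  + c123 *: Cl03_I.

Lemma Cl03_e12E : Cl03_e12 = Cl03_of_seq [:: 0; 0; 0; 0; 1; 0; 0; 0].
Proof.
rewrite /Cl03_e12 Cl03_mulE Cl03_mul_seq.
by congr (Cl03_of_seq [:: _; _; _; _; _; _; _; _]); ring.
Qed.

Lemma Cl03_e13E : Cl03_e13 = Cl03_of_seq [:: 0; 0; 0; 0; 0; 1; 0; 0].
Proof.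
rewrite /Cl03_e13 Cl03_mulE Cl03_mul_seq.
by congr (Cl03_of_seq [:: _; _; _; _; _; _; _; _]); ring.
Qed.

Lemma Cl03_e23E : Cl03_e23 = Cl03_of_seq [:: 0; 0; 0; 0; 0; 0; 1; 0].
Proof.
rewrite /Cl03_e23 Cl03_mulE Cl03_mul_seq.
by congr (Cl03_of_seq [:: _; _; _; _; _; _; _; _]); ring.
Qed.

Lemma Cl03_IE : Cl03_I = Cl03_of_seq [:: 0; 0; 0; 0; 0; 0; 0; 1].
Proof.
rewrite /Cl03_I -/Cl03_e12 Cl03_e12E Cl03_mulE Cl03_mul_seq.
by congr (Cl03_of_seq [:: _; _; _; _; _; _; _; _]); ring.
Qed.

Lemma Cl03_mvE (c0 c1 c2 c3 c12 c13 c23 c123 : R) :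
  Cl03_mv c0 c1 c2 c3 c12 c13 c23 c123 =
  Cl03_of_seq [:: c0; c1; c2; c3; c12; c13; c23; c123].
Proof.
rewrite /Cl03_mv Cl03_e12E Cl03_e13E Cl03_e23E Cl03_IE Cl03_oneE Cl03_of_seq1.
rewrite !Cl03_scale_seq !Cl03_add_seq.
by congr (Cl03_of_seq [:: _; _; _; _; _; _; _; _]); ring.
Qed.

(* The next three lemmas characterize Cl_{0,3}: the generators satisfy the
   defining relations, and the eight products form a basis. *)
Lemma Cl03_sqr :
  [/\ Cl03_e1 ^+ 2 = -1, Cl03_e2 ^+ 2 = -1 & Cl03_e3 ^+ 2 = -1].
Proof.
have -> : -1 = Cl03_of_seq [:: -1; 0; 0; 0; 0; 0; 0; 0] :> Cl03 R.
  rewrite -[LHS]scaleN1r Cl03_oneE Cl03_of_seq1 Cl03_scale_seq.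
  by congr (Cl03_of_seq [:: _; _; _; _; _; _; _; _]); ring.
by rewrite !expr2 !Cl03_mulE !Cl03_mul_seq; split;
  congr (Cl03_of_seq [:: _; _; _; _; _; _; _; _]); ring.
Qed.

Lemma Cl03_anticomm :
  [/\ Cl03_e1 * Cl03_e2 + Cl03_e2 * Cl03_e1 = 0,
      Cl03_e1 * Cl03_e3 + Cl03_e3 * Cl03_e1 = 0 &
      Cl03_e2 * Cl03_e3 + Cl03_e3 * Cl03_e2 = 0].
Proof.
have -> : 0 = Cl03_of_seq [:: 0; 0; 0; 0; 0; 0; 0; 0] :> Cl03 R.
  by apply/rowP => i; rewrite !mxE; case: i; do 8 case=> //.
by rewrite !Cl03_mulE !Cl03_mul_seq !Cl03_add_seq; split;
  congr (Cl03_of_seq [:: _; _; _; _; _; _; _; _]); ring.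
Qed.

Lemma Cl03_mv_basis (x : Cl03 R) (c0 c1 c2 c3 c12 c13 c23 c123 : R) :
  x = Cl03_mv c0 c1 c2 c3 c12 c13 c23 c123 <->
  [:: c0; c1; c2; c3; c12; c13; c23; c123] =
  [seq x`[k] | k <- iota 0 8].
Proof.
rewrite Cl03_mvE; split => [-> /=|xE]; first by rewrite !Cl03_coordK.
by rewrite xE; apply: Cl03P; do 8 (case; first by rewrite Cl03_coordK).
Qed.

End Cl03_basis.

Arguments Cl03_e1 {R}.
Arguments Cl03_e2 {R}.
Arguments Cl03_e3 {R}.
Arguments Cl03_e12 {R}.
Arguments Cl03_e13 {R}.
Arguments Cl03_e23 {R}.
Arguments Cl03_I {R}.

Definition Cl03_exp_series (R : realType) (A : Cl03 R) : (Cl03 R)^nat :=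
  series (fun k => (k`!%:R : R)^-1 *: A ^+ k).

(* Meaningful because the series converges; [lim] is a junk value otherwise. *)
Definition Cl03_exp (R : realType) (A : Cl03 R) : Cl03 R :=
  limn (Cl03_exp_series A).

(* sin a / a, with the value 0 (and not the limit 1) at a = 0. *)
Definition sin_ratio (R : realType) (a : R) : R :=
  if a == 0 then 0 else sin a / a.

(* Main.v *)
(* The pseudoscalar I is central with I^2 = 1, so E = (1 + eps I) / 2, for
   eps = 1 and eps = -1, are complementary central idempotents.  On the ideal
   of E, multiplication by A is multiplication by l + v with l real and v a
   vector, and v^2 = - a^2 where a is a_+ or a_-.  Hence (E, v E / a) behaves
   like (1, i) under multiplication by l + i a, and E A^k has the real and
   imaginary parts of (l + i a)^k as coordinates.  The exponential generating
   functions of these two sequences solve the linear system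
   f' = l f - a g, g' = a f + l g, whence f = e^(l t) cos (a t) and
   g = e^(l t) sin (a t). *)
Require Import Defs.
From mathcomp Require Import all_boot all_order all_algebra.
From mathcomp Require Import all_classical all_reals all_analysis.
From mathcomp Require Import ring.
Import Order.TTheory GRing.Theory Num.Theory.
Import numFieldNormedType.Exports.
Local Open Scope classical_set_scope.
Local Open Scope ring_scope.

Set Implicit Arguments.
Unset Strict Implicit.

(** * Exponential generating functions of sequences with geometric growth *)

Section exponential_generating_series.
Variable R : realType.
Implicit Types (u : R^nat) (x B M : R).

Definition egf u x : R := limn (pseries (fun k => (k`!%:R)^-1 * u k) x).

Lemma egf0 u : egf u 0 = u 0%N.
Proof.
apply: lim_near_cst => //; near=> m; rewrite -[m]prednK; last by near: m.
rewrite /pseries /series /= big_nat_recl//= big1 ?addr0.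
  by rewrite expr0 fact0 invr1 mul1r mulr1.
by move=> i _; rewrite expr0n mulr0.
Unshelve. all: by end_near. Qed.

(** Absolute convergence by comparison with the series of [B] exp([M] |x|). *)
Lemma is_cvg_egf u B M x : 0 <= M -> (forall k, `|u k| <= B * M ^+ k) ->
  cvgn (pseries (fun k => (k`!%:R)^-1 * u k) x).
Proof.
move=> M0 uM; apply: normed_cvg.
have B0 : 0 <= B by have := le_trans (normr_ge0 _) (uM 0%N); rewrite expr0 mulr1.
apply: (@series_le_cvg _ _ (B *: exp_coeff (M * `|x|))) => [n|n|n|] //=.
- by rewrite mulr_ge0// exp_coeff_ge0// mulr_ge0.
- rewrite !normrM normrX normfV normr_nat.
  have := uM n.
  rewrite -(ler_pM2l (_ : 0 < n`!%:R^-1)) ?invr_gt0 ?ltr0n ?fact_gt0//.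
  move=> /(ler_wpM2r (exprn_ge0 n (normr_ge0 x))) /le_trans; apply.
  suff -> : (B *: exp_coeff (M * `|x|)) n =
      n`!%:R^-1 * (B * M ^+ n) * `|x| ^+ n by [].
  by rewrite !fctE /exp_coeff /= exprMn /GRing.scale /=; ring.
- by apply: is_cvg_seriesZ; exact: is_cvg_series_exp_coeff.
Qed.

Lemma pseries_diffs_egf u :
  pseries_diffs (fun k => (k`!%:R)^-1 * u k) =
  (fun k => (k`!%:R)^-1 * u k.+1).
Proof.
apply/funext => k.
by rewrite /pseries_diffs factS natrM invfM -!mulrA mulVKf.
Qed.

(** Since (k+1)/(k+1)! = 1/k!, termwise differentiation shifts the sequence. *)
Lemma is_derive_egf u B M x : 0 <= M -> (forall k, `|u k| <= B * M ^+ k) ->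
  is_derive x 1 (egf u) (egf (fun k => u k.+1) x).
Proof.
move=> M0 uM; rewrite /egf -pseries_diffs_egf.
(* Termwise differentiation at [x] uses convergence of the series and of its first two formal
   derivatives ([j] = 0, 1, 2) at a point of larger modulus; a shift by [j] only changes the
   constant to [B * M ^+ j]. *)
have sh j : cvgn (pseries (fun k => (k`!%:R)^-1 * u (j + k)%N) (`|x| + 1)).
  apply: (@is_cvg_egf _ (B * M ^+ j) M) => // k.
  by rewrite -mulrA -exprD.
apply: (@pseries_snd_diffs _ _ (`|x| + 1)); rewrite ?pseries_diffs_egf.
- exact: (sh 0%N).
- exact: (sh 1%N).
- exact: (sh 2%N).
- by rewrite [ltRHS]ger0_norm ?addr_ge0// ltrDl.
Qed.

Lemma egfD u v x B M : 0 <= M -> (forall k, `|u k| <= B * M ^+ k) ->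
  (forall k, `|v k| <= B * M ^+ k) -> forall c d,
  egf (fun k => c * u k + d * v k) x = c * egf u x + d * egf v x.
Proof.
move=> M0 uM vM c d; apply: cvg_lim => //.
have cu := @is_cvg_egf _ _ _ x M0 uM.
have cv := @is_cvg_egf _ _ _ x M0 vM.
rewrite [X in X @ _](_ : _ =
   c *: pseries (fun k => (k`!%:R)^-1 * u k) x +
   d *: pseries (fun k => (k`!%:R)^-1 * v k) x).
  by apply: cvgD; apply: cvgZl_tmp.
rewrite /pseries -!seriesZ -seriesD; congr series; apply/funext => k.
rewrite !fctE /GRing.scale /=; ring.
Qed.

End exponential_generating_series.

(** * Powers of l + i a and their action through right multiplication by A *)

Section rotation.
Variable R : realType.
Variables l a : R.

(* Real and imaginary parts of [(l + i a) ^ k]. *)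
Fixpoint rot k : R * R :=
  if k is k'.+1 then
    (l * (rot k').1 - a * (rot k').2, a * (rot k').1 + l * (rot k').2)
  else (1, 0).

(** A crude bound in place of |l + i a|^k: one step of the recursion enlarges a common bound on both
    components by a factor of at most |l| + |a|. *)
Lemma rot_bound k : `|(rot k).1| <= (`|l| + `|a|) ^+ k /\
                    `|(rot k).2| <= (`|l| + `|a|) ^+ k.
Proof.
elim: k => [|k [IH1 IH2]]; first by rewrite /= normr1 normr0 expr0.
rewrite exprS mulrDl /=; split.
  by apply: le_trans (ler_normB _ _) _; rewrite !normrM lerD// ler_wpM2l.
apply: le_trans (ler_normD _ _) _; rewrite !normrM addrC lerD// ler_wpM2l//.
Qed.

Let rot_bound1 k : `|(rot k).1| <= 1 * (`|l| + `|a|) ^+ k.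
Proof. by rewrite mul1r; case: (rot_bound k). Qed.
Let rot_bound2 k : `|(rot k).2| <= 1 * (`|l| + `|a|) ^+ k.
Proof. by rewrite mul1r; case: (rot_bound k). Qed.
Let bound_ge0 : 0 <= `|l| + `|a|. Proof. exact: addr_ge0. Qed.

Lemma egf_rot t : egf (fun k => (rot k).1) t = expR (l * t) * cos (a * t) /\
                  egf (fun k => (rot k).2) t = expR (l * t) * sin (a * t).
Proof.
pose F := egf (fun k => (rot k).1); pose S := egf (fun k => (rot k).2).
(* The recursion of [rot] turns the shifted sequence into the right-hand side of the linear
   system. *)
have dF (x : R) : is_derive x (1 : R) F (l * F x - a * S x).
  apply: is_derive_eq (is_derive_egf _ bound_ge0 rot_bound1) _ => /=.
  rewrite -mulNr -(egfD _ bound_ge0 rot_bound1 rot_bound2).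
  by congr egf; apply/funext => k; rewrite mulNr.
have dS (x : R) : is_derive x (1 : R) S (a * F x + l * S x).
  apply: is_derive_eq (is_derive_egf _ bound_ge0 rot_bound2) _ => /=.
  by rewrite -(egfD _ bound_ge0 rot_bound1 rot_bound2).
have dlin c (x : R) : is_derive x (1 : R) ( *%R c) c.
  by apply: is_derive_eq; rewrite /GRing.scale /= mulr1.
have de (x : R) : is_derive x (1 : R) (fun x => expR (- l * x)) (expR (- l * x) * - l).
  exact: is_derive1_comp.
have dc (x : R) : is_derive x (1 : R) (fun x => cos (a * x)) (- sin (a * x) * a).
  exact: is_derive1_comp.
have ds (x : R) : is_derive x (1 : R) (fun x => sin (a * x)) (cos (a * x) * a).
  exact: is_derive1_comp.
(* The solution [(F, S)] rotated back and rescaled is constant. *)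
have h1 : expR (- l * t) * (F t * cos (a * t) + S t * sin (a * t)) = 1.
  pose f x := expR (- l * x) * (F x * cos (a * x) + S x * sin (a * x)).
  rewrite -/(f t); apply: (@eq_trans _ _ (f 0)); last first.
    by rewrite /f /F /S !egf0 !mulr0 expR0 cos0 sin0 /=; ring.
  apply: is_derive_0_is_cst => x; apply: is_derive_eq.
  rewrite /GRing.scale /=; ring.
have h2 : expR (- l * t) * (S t * cos (a * t) - F t * sin (a * t)) = 0.
  pose f x := expR (- l * x) * (S x * cos (a * x) - F x * sin (a * x)).
  rewrite -/(f t); apply: (@eq_trans _ _ (f 0)); last first.
    by rewrite /f /F /S !egf0 !mulr0 expR0 cos0 sin0 /=; ring.
  apply: is_derive_0_is_cst => x; apply: is_derive_eq.
  rewrite /GRing.scale /=; ring.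
have e : expR (l * t) * expR (- l * t) = 1.
  by rewrite mulNr expRxMexpNx_1.
have cs := cos2Dsin2 (a * t).
rewrite -/(F t) -/(S t).
set p := expR (- l * t) in h1 h2 e; set q := expR (l * t) in e *.
set c := cos _ in h1 h2 cs *; set s := sin _ in h1 h2 cs *.
(* [h1] and [h2] are the real and imaginary parts of e^(-lt) e^(-iat) (F + iS) = 1. Multiplying by
   e^(lt) e^(iat) isolates F and S. *)
split.
  transitivity ((q * p) * (c ^+ 2 + s ^+ 2) * F t); first by
    rewrite e cs !mul1r.
  transitivity (q * c * (p * (F t * c + S t * s))
                - q * s * (p * (S t * c - F t * s))); first by ring.
  by rewrite h1 h2 mulr1 mulr0 subr0.
transitivity ((q * p) * (c ^+ 2 + s ^+ 2) * S t); first by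
    rewrite e cs !mul1r.
transitivity (q * s * (p * (F t * c + S t * s))
              + q * c * (p * (S t * c - F t * s))); first by ring.
by rewrite h1 h2 mulr1 mulr0 addr0.
Qed.

Lemma cvg_series_rot :
  series (fun k => (k`!%:R)^-1 * (rot k).1) @ \oo --> expR l * cos a /\
  series (fun k => (k`!%:R)^-1 * (rot k).2) @ \oo --> expR l * sin a.
Proof.
have [e1 e2] := egf_rot 1; rewrite !mulr1 in e1 e2.
have p1 (u : R^nat) : pseries u 1 = series u.
  by rewrite /pseries; congr series; apply/funext => k; rewrite /= expr1n mulr1.
rewrite -e1 -e2 /egf !p1 -!(p1 (fun k => _ * _)).
by split; apply: is_cvg_egf bound_ge0 _.
Qed.

Variables A E F : Cl03 R.
Hypothesis EA : E * A = l *: E + a *: F.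
Hypothesis FA : F * A = l *: F - a *: E.

Lemma mul_exp_rot k : E * A ^+ k = (rot k).1 *: E + (rot k).2 *: F.
Proof.
elim: k => [|k IH]; first by rewrite expr0 mulr1 /= scale1r scale0r addr0.
rewrite exprSr mulrA IH mulrDl -!scalerAl EA FA /=.
rewrite scalerBr !scalerDr !scalerA !scalerDl !scaleNr.
rewrite ![_ * l]mulrC ![_ * a]mulrC.
by rewrite addrACA [RHS]addrAC -!addrA; congr (_ + _); rewrite addrCA.
Qed.

(** By [mul_exp_rot], the partial sums times [E] are combinations of [E] and [F] with scalar series
    as coefficients. *)
Lemma cvg_mul_exp_series :
  E * Cl03_exp_series A n @[n --> \oo] -->
  (expR l * cos a) *: E + (expR l * sin a) *: F.
Proof.
have [c1 c2] := cvg_series_rot.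
rewrite [X in X @ _](_ : _ = fun n =>
  series (fun k => (k`!%:R)^-1 * (rot k).1) n *: E +
  series (fun k => (k`!%:R)^-1 * (rot k).2) n *: F).
  by apply: cvgD; apply: cvgZr_tmp.
apply/funext => n; rewrite /Cl03_exp_series /series /=.
rewrite mulr_sumr !scaler_suml -big_split /=; apply: eq_bigr => k _.
by rewrite -scalerAr mul_exp_rot scalerDr !scalerA.
Qed.

End rotation.

(** * The two central idempotents and the action of A on their ideals *)

Section central_idempotents.
Variables (R : realType) (eps : R).
Hypothesis eps_sign : eps = 1 \/ eps = -1.

Definition central_idem : Cl03 R :=
  Cl03_of_seq [:: 2^-1; 0; 0; 0; 0; 0; 0; 2^-1 * eps].

(* The vector with coordinates [p1, p2, p3] times [central_idem]. *)
Definition idem_vector (p1 p2 p3 : R) : Cl03 R :=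
  2^-1 *: Cl03_of_seq [:: 0; p1; p2; p3; - eps * p3; eps * p2; - eps * p1; 0].

Variables a0 a1 a2 a3 a12 a13 a23 a123 : R.
Let A : Cl03 R := Cl03_of_seq [:: a0; a1; a2; a3; a12; a13; a23; a123].
(** On the ideal of E, I acts as [eps]; hence e23 = - e1 I, e13 = e2 I and e12 = - e3 I fold the
    bivector part into the vector part. *)
Let u1 := a1 - eps * a23.
Let u2 := a2 + eps * a13.
Let u3 := a3 - eps * a12.
Let a := Num.sqrt (u3 ^+ 2 + u2 ^+ 2 + u1 ^+ 2).
Let E := central_idem.
Let F := idem_vector (u1 / a) (u2 / a) (u3 / a).

Lemma idem_mul : E * A = (a0 + eps * a123) *: E + a *: F /\
                 F * A = (a0 + eps * a123) *: F - a *: E.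
Proof.
have sqr_a : a ^+ 2 = u3 ^+ 2 + u2 ^+ 2 + u1 ^+ 2.
  by rewrite sqr_sqrtr// !addr_ge0// sqr_ge0.
have u_a : [/\ u1 = a * (u1 / a), u2 = a * (u2 / a) & u3 = a * (u3 / a)].
  (* If [a = 0] then [u1 = u2 = u3 = 0], and [F = 0] since [x / 0 = 0]. *)
  have [a_0|a_neq0] := eqVneq a 0; last by split; rewrite mulrC divfK.
  rewrite a_0 !mul0r; move/eqP: sqr_a; rewrite a_0 expr0n /= eq_sym.
  rewrite !paddr_eq0 ?addr_ge0 ?sqr_ge0// !sqrf_eq0.
  by move=> /andP[/andP[/eqP-> /eqP->] /eqP->].
move: u_a sqr_a; rewrite /F.
move: (u1 / a) (u2 / a) (u3 / a) => p1 p2 p3 [e1 e2 e3].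
rewrite e1 e2 e3 => sqr_a.
(* The unit length of p, multiplied by [a] so that it survives [a = 0]. *)
have pp : a * (p1 ^+ 2 + p2 ^+ 2 + p3 ^+ 2) = a.
  have [->|a_neq0] := eqVneq a 0; first by rewrite mul0r.
  by apply: (mulfI a_neq0); rewrite -[RHS]expr2 sqr_a; ring.
have {e1} a1E : a1 = a * p1 + eps * a23 by rewrite -e1 /u1 subrK.
have {e2} a2E : a2 = a * p2 - eps * a13 by rewrite -e2 /u2 addrK.
have {e3} a3E : a3 = a * p3 + eps * a12 by rewrite -e3 /u3 subrK.
rewrite -scaleNr /E /central_idem /idem_vector /A a1E a2E a3E.
clear -eps_sign pp; move: (a) pp => b pp.
(* The product of [F] with the vector part of A is - a |p|^2 E; rewriting [a] this way leaves
   polynomial identities. *)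
rewrite -[X in - X *: _]pp.
rewrite !Cl03_mulE !Cl03_scale_seq !Cl03_mul_seq !Cl03_add_seq.
by move: (2^-1) => h; case: eps_sign => ->; split;
  congr (Cl03_of_seq [:: _; _; _; _; _; _; _; _]); ring.
Qed.

Lemma cvg_idem_exp_series :
  E * Cl03_exp_series A n @[n --> \oo] -->
  (expR (a0 + eps * a123) * cos a) *: E + (expR (a0 + eps * a123) * sin a) *: F.
Proof. by have [? ?] := idem_mul; exact: cvg_mul_exp_series. Qed.

End central_idempotents.

(** * Recombination of the two ideals *)

Lemma central_idemD (R : realType) :
  central_idem 1 + central_idem (-1) = 1 :> Cl03 R.
Proof.
rewrite Cl03_oneE Cl03_of_seq1 Cl03_add_seq.
by congr (Cl03_of_seq [:: _; _; _; _; _; _; _; _]); field.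
Qed.

(** At [a = 0] the quotient also vanishes, since sin 0 = 0; the special cases thus follow the
    general computation. *)
Lemma sin_ratioE (R : realType) (a : R) : sin_ratio a = sin a / a.
Proof. by rewrite /sin_ratio; case: eqP => // ->; rewrite sin0 mul0r. Qed.

Unset Implicit Arguments.

Theorem theorem3p1 (R : realType) (a0 a1 a2 a3 a12 a13 a23 a123 : R) :
  let A : Cl03 R :=
    a0%:A + a1 *: Cl03_e1 + a2 *: Cl03_e2 + a3 *: Cl03_e3
    + a12 *: Cl03_e12 + a13 *: Cl03_e13 + a23 *: Cl03_e23
    + a123 *: Cl03_I in
  let ap := Num.sqrt ((a3 - a12) ^+ 2 + (a2 + a13) ^+ 2 + (a1 - a23) ^+ 2) in
  let am := Num.sqrt ((a3 + a12) ^+ 2 + (a2 - a13) ^+ 2 + (a1 + a23) ^+ 2) in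
  let b0 := 2^-1 * expR a0 *
    (expR a123 * cos ap + expR (- a123) * cos am) in
  let b123 := 2^-1 * expR a0 *
    (expR a123 * cos ap - expR (- a123) * cos am) in
  let b1 := 2^-1 * expR a0 *
    (expR a123 * (a1 - a23) * sin_ratio ap
     + expR (- a123) * (a1 + a23) * sin_ratio am) in
  let b2 := 2^-1 * expR a0 *
    (expR a123 * (a2 + a13) * sin_ratio ap
     + expR (- a123) * (a2 - a13) * sin_ratio am) in
  let b3 := 2^-1 * expR a0 *
    (expR a123 * (a3 - a12) * sin_ratio ap
     + expR (- a123) * (a3 + a12) * sin_ratio am) in
  let b12 := 2^-1 * expR a0 *
    (- expR a123 * (a3 - a12) * sin_ratio ap
     + expR (- a123) * (a3 + a12) * sin_ratio am) in
  let b13 := 2^-1 * expR a0 *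
    (expR a123 * (a2 + a13) * sin_ratio ap
     - expR (- a123) * (a2 - a13) * sin_ratio am) in
  let b23 := 2^-1 * expR a0 *
    (- expR a123 * (a1 - a23) * sin_ratio ap
     + expR (- a123) * (a1 + a23) * sin_ratio am) in
  cvgn (Cl03_exp_series A) /\
  Cl03_exp A =
    b0%:A + b1 *: Cl03_e1 + b2 *: Cl03_e2 + b3 *: Cl03_e3
    + b12 *: Cl03_e12 + b13 *: Cl03_e13 + b23 *: Cl03_e23
    + b123 *: Cl03_I.
Proof.
move=> A ap am b0 b123 b1 b2 b3 b12 b13 b23.
pose s : Cl03 R := Cl03_of_seq [:: a0; a1; a2; a3; a12; a13; a23; a123].
have AE : A = s by exact: Cl03_mvE.
pose B := Cl03_mv b0 b1 b2 b3 b12 b13 b23 b123.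
suff cA : Cl03_exp_series A @ \oo --> B.
  by split; [apply/cvg_ex; exists B | exact: cvg_lim cA].
(* [eps = 1] yields [ap] and the exponent a0 + a123; [eps = -1] yields [am] and a0 - a123. *)
have := @cvg_idem_exp_series R 1 (or_introl erefl) a0 a1 a2 a3 a12 a13 a23 a123.
have := @cvg_idem_exp_series R (-1) (or_intror erefl) a0 a1 a2 a3 a12 a13 a23 a123.
rewrite !mulN1r !mul1r !opprK -/ap -/am -/s -AE => cvg_m cvg_p.
have -> : Cl03_exp_series A = fun n => central_idem 1 * Cl03_exp_series A n +
                                       central_idem (-1) * Cl03_exp_series A n.
  by apply/funext => n; rewrite -mulrDl central_idemD mul1r.
suff -> : B = (expR (a0 + a123) * cos ap) *: central_idem 1 +
    (expR (a0 + a123) * sin ap) *: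
      idem_vector 1 ((a1 - a23) / ap) ((a2 + a13) / ap) ((a3 - a12) / ap) +
   ((expR (a0 - a123) * cos am) *: central_idem (-1) +
    (expR (a0 - a123) * sin am) *:
      idem_vector (-1) ((a1 + a23) / am) ((a2 - a13) / am) ((a3 + a12) / am)).
  exact: cvgD cvg_p cvg_m.
rewrite /B Cl03_mvE /central_idem /idem_vector !Cl03_scale_seq !Cl03_add_seq.
rewrite /b0 /b1 /b2 /b3 /b12 /b13 /b23 /b123 !sin_ratioE !expRD.
by congr (Cl03_of_seq [:: _; _; _; _; _; _; _; _]); ring.
Qed.
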